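(* Let $\mathbb{A}$ and $\mathbb{B}$ be two infinite alphabets of independent indeterminates, and work with formal power series in $z$ whose coefficients lie in the field of fractions of the ring generated by the complete functions $S_i(\mathbb{A}), S_i(\mathbb{B})$, $i\ge 1$. (1) Let $f_{-1}(z)=\sigma_z(\mathbb{A})$, $f_0(z)=1$, and let $f_1,f_2,\dots$ be the successive remainders of the Euclidean division (as defined in the context) of $\sigma_z(\mathbb{A})$ by $1$. Then for every integer $k\ge 1$, $$ f_k(z) = S_{(k+1)^k}(\mathbb{A})^{-1}\sum_{i=0}^\infty z^i\, S_{k+1+i,(k+1)^{k-1}}(\mathbb{A}). $$ (2) Let $f_{-1}(z)=\sigma_z(\mathbb{A})$, $f_0(z)=\sigma_z(\mathbb{B})$, and let $f_1,f_2,\dots$ be the successive remainders of the Euclidean division of $\sigma_z(\mathbb{A})$ by $\sigma_z(\mathbb{B})$. Then for every integer $k\ge 1$, $$ f_k(z) = S_{(k+1)^k}(\mathbb{A}-\mathbb{B})^{-1}\,\sigma_z(\mathbb{B})\sum_{i=0}^\infty z^i\, S_{k+1+i,(k+1)^{k-1}}(\mathbb{A}-\mathbb{B}). $$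
   Context: For an alphabet (set of indeterminates) $\mathbb{A}$, $\sigma_z(\mathbb{A}):=\prod_{a\in\mathbb{A}}(1-za)^{-1}=\sum_{i\ge0} z^i S_i(\mathbb{A})$; the $S_i(\mathbb{A})$ are the complete functions, with $S_0=1$ and $S_i=0$ for $i<0$. For two alphabets, $\sigma_z(\mathbb{A}-\mathbb{B}):=\sigma_z(\mathbb{A})/\sigma_z(\mathbb{B})=\prod_{b\in\mathbb{B}}(1-zb)/\prod_{a\in\mathbb{A}}(1-za)=\sum_{i\ge 0} z^iS_i(\mathbb{A}-\mathbb{B})$, again with $S_i(\mathbb{A}-\mathbb{B})=0$ for $i<0$. For a sequence $\lambda=(\lambda_1,\dots,\lambda_\ell)$ of integers, the Schur function is $S_\lambda(\mathbb{A}-\mathbb{B})=\det\bigl(S_{\lambda_i+j-i}(\mathbb{A}-\mathbb{B})\bigr)_{1\le i,j\le \ell}$ (and $S_\lambda(\mathbb{A})$ is the case $\mathbb{B}=\emptyset$). Exponent notation: $m^r$ denotes $r$ parts equal to $m$; thus $(k+1)^k=(k+1,\dots,k+1)$ ($k$ parts) and $(k+1+i,(k+1)^{k-1})=(k+1+i,k+1,\dots,k+1)$ with $k-1$ parts $k+1$ after the first. Euclidean division of series: a unitary series is $1+c_1z+c_2z^2+\cdots$. Given unitary series $f_{-1},f_0$, one defines recursively for $k\ge0$ the unitary series $f_{k+1}$ and scalars $\alpha_k,\beta_k$ (with $\beta_k\neq 0$) as the unique ones satisfying $f_{k-1}(z)=(1+\alpha_k z)f_k(z)+\beta_k z^2 f_{k+1}(z)$;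 that is, $f_{k+1}=\bigl(f_{k-1}-(1+\alpha_kz)f_k\bigr)\beta_k^{-1}z^{-2}$. The series $f_k$, $k\ge1$, are the successive remainders (''$k$-th remainder'' $=f_k$) of the division of $f_{-1}$ by $f_0$. *)

(* Defs.v *)
From HB Require Import structures.
From mathcomp Require Import all_boot all_order all_algebra finmap.
From mathcomp Require Import boolp classical_sets functions cardinality.
From mathcomp.multinomials Require Import monalg.
From mathcomp.multinomials Require mpoly.

Set Implicit Arguments.
Unset Strict Implicit.
Unset Printing Implicit Defensive.

Import GRing.Theory.

Local Open Scope ring_scope.

Section ClassicalUnit.
Variable R : comNzRingType.

Definition classical_unit : {pred R} := fun x => `[< exists y, y * x = 1 >].

(* Fallback value [x] on non-units, as for every [unitRingType]. *)
Definition classical_inv (x : R) : R :=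
  if pselect (exists y, y * x = 1) is left h then projT1 (cid h) else x.

Lemma classical_mulVr : {in classical_unit, left_inverse 1 classical_inv *%R}.
Proof.
move=> x /asboolP h; rewrite /classical_inv.
by case: pselect => // h'; case: cid.
Qed.

Lemma classical_unitP (x y : R) : y * x = 1 -> classical_unit x.
Proof. by move=> h; apply/asboolP; exists y. Qed.

Lemma classical_inv_out : {in [predC classical_unit], classical_inv =1 id}.
Proof.
move=> x; rewrite inE /= => /asboolP h.
by rewrite /classical_inv; case: pselect.
Qed.

End ClassicalUnit.

Record fps (R : Type) : Type := Fps { fps_coef : nat -> R }.

Notation "{ 'fps' R }" := (fps R) (at level 0, format "{ 'fps'  R }").
Notation "f `[ i ]" := (fps_coef f i)
  (at level 2, left associativity, format "f `[ i ]").

Lemma fpsP (R : Type) (f g : {fps R}) : (forall i, f`[i] = g`[i]) <-> f = g.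
Proof.
split=> [|->//]; case: f g => [f] [g] /= h; congr Fps; exact/funext.
Qed.

HB.instance Definition _ (R : Type) := [isNew for @fps_coef R].
HB.instance Definition _ (R : choiceType) := [Choice of fps R by <:].

Section FpsRing.
Variable R : comNzRingType.
Implicit Types f g h : {fps R}.

Definition fps0 : {fps R} := Fps (fun=> 0).
Definition fps1 : {fps R} := Fps (fun i => (i == 0)%:R).
Definition fps_add f g : {fps R} := Fps (fun i => f`[i] + g`[i]).
Definition fps_opp f : {fps R} := Fps (fun i => - f`[i]).
Definition fps_mul f g : {fps R} :=
  Fps (fun n => \sum_(i < n.+1) f`[i] * g`[n - i]).
Definition fps_scale (c : R) f : {fps R} := Fps (fun i => c * f`[i]).

Lemma fps_addA : associative fps_add.
Proof. by move=> f g h; apply/fpsP => i /=; rewrite addrA. Qed.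
Lemma fps_addC : commutative fps_add.
Proof. by move=> f g; apply/fpsP => i /=; rewrite addrC. Qed.
Lemma fps_add0 : left_id fps0 fps_add.
Proof. by move=> f; apply/fpsP => i /=; rewrite add0r. Qed.
Lemma fps_addN : left_inverse fps0 fps_opp fps_add.
Proof. by move=> f; apply/fpsP => i /=; rewrite addNr. Qed.

HB.instance Definition _ := GRing.isZmodule.Build (fps R)
  fps_addA fps_addC fps_add0 fps_addN.

Let trunc n f : {poly R} := \poly_(i < n.+1) f`[i].

Let truncE n f i : (i <= n)%N -> (trunc n f)`_i = f`[i].
Proof. by move=> le; rewrite coef_poly ltnS le. Qed.

Let fps_mul_trunc n m f g :
  (m <= n)%N -> (fps_mul f g)`[m] = (trunc n f * trunc n g)`_m.
Proof.
move=> le; rewrite coefM /=; apply: eq_bigr => i _.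
rewrite !truncE //; first exact: leq_trans (leq_subr _ _) le.
by apply: leq_trans le; rewrite -ltnS.
Qed.

Lemma fps_mulA : associative fps_mul.
Proof.
move=> f g h; apply/fpsP => n.
transitivity ((trunc n f * (trunc n g * trunc n h))`_n).
  rewrite coefM /=; apply: eq_bigr => i _.
  have le : (i <= n)%N by rewrite -ltnS.
  rewrite truncE // -fps_mul_trunc //; exact: leq_subr.
rewrite mulrA coefM /=; apply: eq_bigr => i _.
have le : (i <= n)%N by rewrite -ltnS.
rewrite -fps_mul_trunc // truncE //; exact: leq_subr.
Qed.

Lemma fps_mulC : commutative fps_mul.
Proof.
by move=> f g; apply/fpsP => n; rewrite !(@fps_mul_trunc n) // mulrC.
Qed.

Lemma fps_mul1 : left_id fps1 fps_mul.
Proof.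
move=> f; apply/fpsP => n /=; rewrite big_ord_recl /= mul1r subn0 big1 ?addr0 //.
by move=> i _; rewrite mul0r.
Qed.

Lemma fps_mulDl : left_distributive fps_mul +%R.
Proof.
move=> f g h; apply/fpsP => n /=; rewrite -big_split /=.
by apply: eq_bigr => i _; rewrite mulrDl.
Qed.

Lemma fps_oner_neq0 : fps1 != 0.
Proof.
apply/eqP => /(congr1 (fun f => f`[0])) /= /eqP; exact/negP/oner_neq0.
Qed.

HB.instance Definition _ := GRing.Zmodule_isComNzRing.Build (fps R)
  fps_mulA fps_mulC fps_mul1 fps_mulDl fps_oner_neq0.

HB.instance Definition _ := GRing.ComNzRing_hasMulInverse.Build (fps R)
  (@classical_mulVr (fps R)) (@classical_unitP (fps R))
  (@classical_inv_out (fps R)).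

Lemma fps_scaleA a b f : fps_scale a (fps_scale b f) = fps_scale (a * b) f.
Proof. by apply/fpsP => i /=; rewrite mulrA. Qed.
Lemma fps_scale1 : left_id 1 fps_scale.
Proof. by move=> f; apply/fpsP => i /=; rewrite mul1r. Qed.
Lemma fps_scaleDr : right_distributive fps_scale +%R.
Proof. by move=> a f g; apply/fpsP => i /=; rewrite mulrDr. Qed.
Lemma fps_scaleDl f : {morph fps_scale^~ f : a b / a + b}.
Proof. by move=> a b; apply/fpsP => i /=; rewrite mulrDl. Qed.

HB.instance Definition _ := GRing.Zmodule_isLmodule.Build R (fps R)
  fps_scaleA fps_scale1 fps_scaleDr fps_scaleDl.

Definition fpsz : {fps R} := Fps (fun i => (i == 1)%:R).

Lemma fps_coef0 i : (0 : {fps R})`[i] = 0. Proof. by []. Qed.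
Lemma fps_coef1 i : (1 : {fps R})`[i] = (i == 0)%:R. Proof. by []. Qed.
Lemma fps_coefD f g i : (f + g)`[i] = f`[i] + g`[i]. Proof. by []. Qed.
Lemma fps_coefN f i : (- f)`[i] = - f`[i]. Proof. by []. Qed.
Lemma fps_coefZ c f i : (c *: f)`[i] = c * f`[i]. Proof. by []. Qed.
Lemma fps_coefM f g n :
  (f * g)`[n] = \sum_(i < n.+1) f`[i] * g`[n - i].
Proof. by []. Qed.

Lemma geometric_mul (c : R) :
  Fps (fun i => c ^+ i) * (1 - c *: fpsz) = 1.
Proof.
apply/fpsP => n; rewrite mulrC fps_coefM fps_coef1 big_ord_recl /=.
rewrite mulr0 subr0 mul1r subn0; case: n => [|n]; first by rewrite big_ord0 addr0.
rewrite big_ord_recl /= big1 => [|i _]; last by rewrite mulr0 subr0 mul0r.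
by rewrite mulr1 sub0r addr0 /bump /= subn1 /= mulNr -exprS subrr.
Qed.

Lemma geometric_unit (c : R) : (1 - c *: fpsz) \is a GRing.unit.
Proof. by apply/unitrPr; exists (Fps (fun i => c ^+ i)); rewrite mulrC geometric_mul. Qed.

End FpsRing.

Notation "''z'" := (fpsz _) (at level 0).

Definition map_fps (R S : Type) (phi : R -> S) (f : {fps R}) : {fps S} :=
  Fps (fun i => phi f`[i]).

Section MapFps.
Variables (R S : comNzRingType) (phi : {rmorphism R -> S}).

Lemma map_fps_is_zmod_morphism : zmod_morphism (map_fps phi).
Proof. by move=> f g; apply/fpsP => i /=; rewrite rmorphB. Qed.

Lemma map_fps_is_monoid_morphism : monoid_morphism (map_fps phi).
Proof.
split; first by apply/fpsP => i /=; rewrite rmorph_nat.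
move=> f g; apply/fpsP => n /=; rewrite rmorph_sum /=.
by apply: eq_bigr => i _; rewrite rmorphM.
Qed.

HB.instance Definition _ := GRing.isZmodMorphism.Build (fps R) (fps S)
  (map_fps phi) map_fps_is_zmod_morphism.
HB.instance Definition _ := GRing.isMonoidMorphism.Build (fps R) (fps S)
  (map_fps phi) map_fps_is_monoid_morphism.

Lemma map_fpsZ c f : map_fps phi (c *: f) = phi c *: map_fps phi f.
Proof. by apply/fpsP => i /=; rewrite rmorphM. Qed.

Lemma map_fpsz : map_fps phi 'z = 'z.
Proof. by apply/fpsP => i /=; rewrite rmorph_nat. Qed.

Lemma map_geometricV c :
  map_fps phi (1 - c *: 'z)^-1 = (1 - phi c *: 'z)^-1.
Proof.
rewrite rmorphV; last exact: geometric_unit.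
by congr _^-1; apply/fpsP => i /=; rewrite rmorphB rmorphM !rmorph_nat.
Qed.

End MapFps.

Notation polyring L := {malg int[{cmonom L}]}.

Section PolyRing.
Variable L : choiceType.
Implicit Types (m : {cmonom L}) (p q : polyring L).

Definition letter (a : L) : polyring L := << ucm a >>%R.

Section Restrict.
Variable D : {pred L}.

Definition restrict_monom m : polyring L :=
  if all [in D] (finsupp m) then << m >>%R else 0.

Lemma restrict_monom_mmorphism : mmorphism restrict_monom.
Proof.
split=> [m1 m2|]; last by rewrite /restrict_monom mdom1 all_nil.
rewrite /restrict_monom; have -> : all [in D] (finsupp (mmul m1 m2)) =
    all [in D] (finsupp m1) && all [in D] (finsupp m2).
  rewrite mdomD; apply/allP/andP => [h|[/allP h1 /allP h2] x].
    by split; apply/allP => x hx; apply: h; rewrite inE hx ?orbT.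
  by rewrite inE => /orP[/h1|/h2].
case: all; rewrite ?mul0r //; case: all; rewrite ?mulr0 //.
by rewrite malgM_def fgmulUU mulr1.
Qed.

HB.instance Definition _ := isMultiplicative.Build {cmonom L} (polyring L)
  restrict_monom restrict_monom_mmorphism.

(* Substitution of 0 for the indeterminates outside [D]. *)
Definition restrict : polyring L -> polyring L :=
  mmap (intr : int -> polyring L) restrict_monom.

HB.instance Definition _ := GRing.RMorphism.on restrict.

Lemma restrict_letter a : restrict (letter a) = if a \in D then letter a else 0.
Proof.
rewrite /restrict /letter mmapU mul1r /restrict_monom mdomU.
have -> // : all [in D] [fset a]%fset = (a \in D).
apply/allP/idP => [->//|h x]; first by rewrite inE.
by rewrite inE => /eqP->.
Qed.

End Restrict.

(* [polyring L] has no zero divisors: the finitely many indeterminates occurring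
   in two given elements reduce this to multinomials over a finite set.  The
   import of [mpoly] is local because its names clash with those of [monalg]. *)

Section ToMpoly.
Import mpoly.
Variable d : seq L.

Definition exponents m : mpoly.multinom (size d) :=
  mpoly.Multinom [tuple m (tnth (in_tuple d) i) | i < size d].

Definition monom_to_mpoly m : mpoly.mpoly (size d) int :=
  mpoly.mpolyX int (exponents m).

Lemma exponentsE m i : mpoly.fun_of_multinom (exponents m) i = m (tnth (in_tuple d) i).
Proof. by rewrite multinomE tnth_mktuple. Qed.

Lemma monom_to_mpoly_mmorphism : mmorphism monom_to_mpoly.
Proof.
split=> [m1 m2|]; rewrite /monom_to_mpoly.
  rewrite -mpoly.mpolyXD; congr mpoly.mpolyX; apply/mpoly.mnmP => i.
  by rewrite mpoly.mnmDE !exponentsE cmM.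
rewrite -mpoly.mpolyX0; congr mpoly.mpolyX; apply/mpoly.mnmP => i.
by rewrite mpoly.mnm0E exponentsE cm1.
Qed.

HB.instance Definition _ := isMultiplicative.Build {cmonom L}
  (mpoly.mpoly (size d) int) monom_to_mpoly monom_to_mpoly_mmorphism.

Definition to_mpoly : polyring L -> mpoly.mpoly (size d) int :=
  monalg.mmap (intr : int -> mpoly.mpoly (size d) int) monom_to_mpoly.

Lemma to_mpoly0 : to_mpoly 0 = 0.
Proof. exact: raddf0. Qed.

Lemma to_mpolyM : {morph to_mpoly : p q / p * q}.
Proof. exact: rmorphM. Qed.

Lemma to_mpoly_mul_eq0 p q :
  p * q = 0 -> to_mpoly p = 0 \/ to_mpoly q = 0.
Proof.
move=> /(congr1 to_mpoly); rewrite to_mpolyM to_mpoly0 => /eqP.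
by rewrite mulf_eq0 => /orP[]/eqP; [left | right].
Qed.

Lemma to_mpoly_eq0 p :
  (forall m, m \in monalg.msupp p -> {subset finsupp m <= d}) ->
  to_mpoly p = 0 -> p = 0.
Proof.
move=> sub p0; apply/eqP; rewrite -monalg.msupp_eq0; apply/negP => /negP/fset0Pn[m mp].
have /eqP := congr1 (mpoly.mcoeff (exponents m)) p0.
rewrite mpoly.mcoeff0 /to_mpoly /monalg.mmap raddf_sum /=.
rewrite (big_fsetD1 m) //= big1_fset => [|m' ]; last first.
  rewrite in_fsetD1 => /andP[ne m'p] _.
  rewrite mulrzl raddfMz /= mpoly.mcoeffX.
  case: eqP => [eqe|]; last by rewrite mul0rz.
  case/eqP: ne; apply/eqP/cmP => a.
  have ex_eq b : b \in d -> m' b = m b.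
    move=> bd; have lt : (index b d < size d)%N by rewrite index_mem.
    have := congr1 (fun e : multinom (size d) => e (Ordinal lt)) eqe.
    by rewrite !exponentsE !(tnth_nth b) /= nth_index.
  have [/ex_eq//|ad] := boolP (a \in d).
  have z m0 : m0 \in monalg.msupp p -> m0 a = 0.
    by move=> /sub s; apply/eqP; rewrite cmE_eq0; apply: contra ad => /s.
  by rewrite !z.
rewrite addr0 mulrzl raddfMz /= mpoly.mcoeffX eqxx intz monalg.mcoeff_eq0.
by rewrite mp.
Qed.

End ToMpoly.

Section Domain.
Import mpoly.

Lemma polyring_mulf_eq0 p q : p * q = 0 -> (p == 0) || (q == 0).
Proof.
pose vars r := flatten [seq enum_fset (finsupp m) | m <- monalg.msupp (r : polyring L)].
pose d := vars p ++ vars q.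
have sub r : {subset vars r <= d} -> to_mpoly d r = 0 -> r = 0.
  move=> rd; apply: to_mpoly_eq0 => m mr x xm; apply: rd.
  by apply/flatten_mapP; exists m.
have subp : {subset vars p <= d} by move=> x xp; rewrite mem_cat xp.
have subq : {subset vars q <= d} by move=> x xq; rewrite mem_cat xq orbT.
by move=> /(@to_mpoly_mul_eq0 d)[/(sub _ subp)|/(sub _ subq)] ->;
  rewrite eqxx ?orbT.
Qed.

End Domain.

End PolyRing.

Section Alphabets.
Variables A B : choiceType.

Definition subalphabets := ({fset A} * {fset B})%type.

(* A function of the alphabets [A] and [B] is encoded by its values on the
   finite subalphabets: the value at [(F, G)] is the polynomial obtained by
   setting to 0 the letters outside [F] and [G].  Taking the letters in the
   disjoint sum [A + B] makes all of them independent. *)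
Definition alphabet_fun := subalphabets -> polyring (A + B)%type.

HB.instance Definition _ := GRing.ComPzRing.on alphabet_fun.

Lemma alphabet_fun_oner_neq0 : (1 : alphabet_fun) != 0.
Proof.
apply/eqP => /(congr1 (fun x : alphabet_fun => x (fset0, fset0))).
by move/eqP; apply/negP; exact: oner_neq0.
Qed.

HB.instance Definition _ :=
  GRing.PzSemiRing_isNonZero.Build alphabet_fun alphabet_fun_oner_neq0.

Definition sigma_fin (T : choiceType) (inj : T -> (A + B)%type) (F : {fset T}) :
    {fps polyring (A + B)%type} :=
  \prod_(a <- F) (1 - letter (inj a) *: 'z)^-1.

Definition completeA (i : nat) : alphabet_fun :=
  fun FG => (sigma_fin inl FG.1)`[i].
Definition completeB (i : nat) : alphabet_fun :=
  fun FG => (sigma_fin inr FG.2)`[i].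

Definition generated : {pred alphabet_fun} := fun x =>
  `[< forall Q : {pred alphabet_fun}, subring_closed Q ->
        (forall i, (0 < i)%N -> completeA i \in Q) ->
        (forall i, (0 < i)%N -> completeB i \in Q) -> x \in Q >].

Lemma generated_subring_closed : subring_closed generated.
Proof.
split.
- by apply/asboolP => Q Qr _ _; have [] := Qr.
- move=> x y /asboolP hx /asboolP hy; apply/asboolP => Q Qr ha hb.
  have [_ QB _] := Qr; apply: QB; [exact: hx | exact: hy].
move=> x y /asboolP hx /asboolP hy; apply/asboolP => Q Qr ha hb.
have [_ _ QM] := Qr; apply: QM; [exact: hx | exact: hy].
Qed.

HB.instance Definition _ := GRing.isSubringClosed.Build alphabet_fun generated
  generated_subring_closed.

Record complete_ring : Type := CompleteRing {
  complete_val : alphabet_fun;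
  complete_valP : complete_val \in generated
}.

HB.instance Definition _ := [isSub for complete_val].
HB.instance Definition _ := [Choice of complete_ring by <:].
HB.instance Definition _ :=
  [SubChoice_isSubComNzRing of complete_ring by <:].

HB.instance Definition _ := GRing.ComNzRing_hasMulInverse.Build complete_ring
  (@classical_mulVr complete_ring) (@classical_unitP complete_ring)
  (@classical_inv_out complete_ring).

Lemma sigma_fin0 (T : choiceType) (inj : T -> (A + B)%type) (F : {fset T}) :
  (sigma_fin inj F)`[0] = 1.
Proof.
rewrite /sigma_fin.
elim/big_ind: _ => [//|f g f0 g0|a _].
  by rewrite fps_coefM big_ord1 f0 g0 mulr1.
have := divrr (geometric_unit (letter (inj a))).
move=> /(congr1 (fun f => f`[0])); rewrite fps_coefM big_ord1 /=.
by rewrite mulr0 subr0 mul1r.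
Qed.

Lemma completeA_generated i : completeA i \in generated.
Proof.
case: i => [|i]; last by apply/asboolP => Q _ QA _; exact: QA.
suff -> : completeA 0 = 1 by exact: rpred1.
by apply/funext => FG; exact: sigma_fin0.
Qed.

Lemma completeB_generated i : completeB i \in generated.
Proof.
case: i => [|i]; last by apply/asboolP => Q _ _ QB; exact: QB.
suff -> : completeB 0 = 1 by exact: rpred1.
by apply/funext => FG; exact: sigma_fin0.
Qed.

Definition in_subalphabets (FG : subalphabets) : {pred (A + B)%type} :=
  fun x => match x with inl a => a \in FG.1 | inr b => b \in FG.2 end.

(* Restricting the value on a pair of subalphabets gives the value on smaller
   ones; all elements of [generated] are of this kind. *)
Definition compatible : {pred alphabet_fun} := fun x =>
  `[< forall FG FG' : subalphabets,
        {subset FG.1 <= FG'.1} -> {subset FG.2 <= FG'.2} ->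
        restrict (in_subalphabets FG) (x FG') = x FG >].

Lemma compatible_subring_closed : subring_closed compatible.
Proof.
split.
- by apply/asboolP => FG FG' _ _; exact: (rmorph1 (restrict _)).
- move=> x y /asboolP hx /asboolP hy; apply/asboolP => FG FG' s1 s2.
  rewrite -[RHS]/(x FG - y FG) -(hx FG FG') // -(hy FG FG') //.
  exact: (rmorphB (restrict _)).
move=> x y /asboolP hx /asboolP hy; apply/asboolP => FG FG' s1 s2.
rewrite -[RHS]/(x FG * y FG) -(hx FG FG') // -(hy FG FG') //.
exact: (rmorphM (restrict _)).
Qed.

Lemma restrict_sigma_fin (T : choiceType) (inj : T -> (A + B)%type)
    (D : {pred (A + B)%type}) (F F' : {fset T}) :
  {subset F <= F'} -> (forall a, (inj a \in D) = (a \in F)) ->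
  map_fps (restrict D) (sigma_fin inj F') = sigma_fin inj F.
Proof.
move=> sub inD; rewrite /sigma_fin rmorph_prod /=.
have E a : map_fps (restrict D) (1 - letter (inj a) *: 'z)^-1 =
    (1 - restrict D (letter (inj a)) *: 'z)^-1.
  exact: map_geometricV.
under eq_bigr => a _ do rewrite E restrict_letter inD.
transitivity (\prod_(a <- F)
    (1 - (if a \in F then letter (inj a) else 0) *: 'z)^-1).
  symmetry; apply: big_fset_incl; first exact/fsubsetP.
  by move=> a _ /negPf ->; rewrite scale0r subr0 invr1.
by apply: eq_big_seq => a ->.
Qed.

Lemma generated_compatible x : x \in generated -> x \in compatible.
Proof.
move=> /asboolP; apply; first exact: compatible_subring_closed.
  move=> i _; apply/asboolP => FG FG' sA sB.
  exact: (congr1 (fun f => f`[i])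
    (restrict_sigma_fin (inj := inl) (D := in_subalphabets FG) sA _)).
move=> i _; apply/asboolP => FG FG' sA sB.
exact: (congr1 (fun f => f`[i])
  (restrict_sigma_fin (inj := inr) (D := in_subalphabets FG) sB _)).
Qed.

Lemma complete_ring_mulf_eq0 (x y : complete_ring) :
  x * y = 0 -> (x == 0) || (y == 0).
Proof.
move=> /(congr1 val); rewrite rmorphM rmorph0 /= => xy0.
have eq0 (u : complete_ring) : (forall FG, val u FG = 0) -> u == 0.
  by move=> u0; apply/eqP/val_inj; rewrite rmorph0; apply/funext.
apply/orP; case: (pselect (forall FG, val x FG = 0)) => [/eq0|/existsNP[FG xFG]].
  by left.
right; apply: eq0 => FG'.
pose U : subalphabets := ((FG.1 `|` FG'.1)%fset, (FG.2 `|` FG'.2)%fset).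
have := congr1 (fun u : alphabet_fun => u U) xy0.
move=> /polyring_mulf_eq0 /orP[] /eqP z0.
  case: xFG; have /asboolP h := generated_compatible (complete_valP x).
  rewrite -[LHS](h FG U).
  - by rewrite [X in restrict _ X]z0 rmorph0.
  - by move=> a aF; rewrite inE aF.
  - by move=> b bG; rewrite inE bG.
have /asboolP h := generated_compatible (complete_valP y).
rewrite -[LHS](h FG' U).
- by rewrite [X in restrict _ X]z0 rmorph0.
- by move=> a aF; rewrite inE aF orbT.
- by move=> b bG; rewrite inE bG orbT.
Qed.

HB.instance Definition _ := GRing.ComUnitRing_isIntegral.Build complete_ring
  complete_ring_mulf_eq0.

Definition complete_field : fieldType := {fraction complete_ring}.

Definition sigmaA : {fps complete_field} :=
  Fps (fun i => tofrac (CompleteRing (completeA_generated i))).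
Definition sigmaB : {fps complete_field} :=
  Fps (fun i => tofrac (CompleteRing (completeB_generated i))).

End Alphabets.

Section Schur.
Variable R : comNzRingType.

(* An alphabet, or a formal difference of alphabets, is given by its
   generating series [sigma]. *)
Definition complete (sigma : {fps R}) (i : int) : R :=
  if i is Posz n then sigma`[n] else 0.

Definition schur (sigma : {fps R}) (la : seq int) : R :=
  \det (\matrix_(i < size la, j < size la)
    complete sigma (la`_i + j%:Z - i%:Z)).

End Schur.

Definition unitary (R : comNzRingType) (f : {fps R}) : Prop := f`[0] = 1.

(* [f k] is the [k]-th remainder of the division of [fm1] by [f 0 = f0]. *)
Definition successive_remainders (K : fieldType) (fm1 f0 : {fps K})
    (f : nat -> {fps K}) : Prop :=
  f 0 = f0 /\
  forall k, unitary (f k.+1) /\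
    exists alpha beta : K, beta != 0 /\
      (if k is j.+1 then f j else fm1) =
        (1 + alpha *: 'z) * f k + beta *: ('z ^+ 2 * f k.+1).

(* Main.v *)
Require Import Defs.
From HB Require Import structures.
From mathcomp Require Import all_boot all_order all_algebra finmap.
From mathcomp Require Import boolp classical_sets functions cardinality.
From mathcomp Require Import zify.
From mathcomp.multinomials Require Import monalg.

(** Dividing by [f_0] reduces the division of sigma(A) by sigma(B) to that of
    s = sigma(A - B) by 1.  There z^(2k) f_k = P s + Q with deg P < k and
    deg Q <= k.  The coefficients of degree k+1, ..., 2k of P s are therefore
    0, ..., 0, 1: a linear system for P whose determinant is S_((k+1)^k), and
    Cramer's rule gives the formula.  The division never stops because these
    determinants do not vanish: emptying B, keeping k letters of A and setting
    them to 1 turns s into (1 - z)^(-k), and then P s satisfies a linear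
    recurrence of order k, for which k consecutive zeros force P = 0. *)

Set Implicit Arguments.
Unset Strict Implicit.
Unset Printing Implicit Defensive.

Import GRing.Theory.

Local Open Scope classical_set_scope.
Local Open Scope ring_scope.

(** * Coefficients and units of formal power series *)

Section PowerSeries.
Variable R : comNzRingType.
Implicit Types f g h s : {fps R}.

Lemma fps_coef0M f g : (f * g)`[0] = f`[0] * g`[0].
Proof. by rewrite fps_coefM big_ord1. Qed.

Lemma fps_coefzM f n : ('z * f)`[n] = if n is m.+1 then f`[m] else 0.
Proof.
rewrite fps_coefM big_ord_recl /= mul0r add0r; case: n => [|n].
  by rewrite big_ord0.
rewrite big_ord_recl /= /bump /= mul1r subn1 big1 ?addr0 // => i _.
by rewrite mul0r.
Qed.

Lemma fps_coefXzM f m n :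
  ('z ^+ m * f)`[n] = if (n < m)%N then 0 else f`[n - m].
Proof.
elim: m n => [|m IHm] n; first by rewrite expr0 mul1r subn0.
by rewrite exprS -mulrA fps_coefzM; case: n => [//|n]; rewrite IHm ltnS subSS.
Qed.

Lemma fps_coefXzDM f m n : ('z ^+ m * f)`[m + n] = f`[n].
Proof. by rewrite fps_coefXzM ltnNge leq_addr addKn. Qed.

Lemma fps_scaleAl c f g : (c *: f) * g = c *: (f * g).
Proof.
apply/fpsP => n; rewrite !(fps_coefM, fps_coefZ) mulr_sumr.
by apply: eq_bigr => i _; rewrite fps_coefZ mulrA.
Qed.

Lemma fps_scaleAr c f g : f * (c *: g) = c *: (f * g).
Proof. by rewrite mulrC fps_scaleAl mulrC. Qed.

Lemma fps_coef_affM c f n :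
  ((1 + c *: 'z) * f)`[n] = f`[n] + c * (if n is m.+1 then f`[m] else 0).
Proof.
by rewrite mulrDl mul1r fps_scaleAl fps_coefD fps_coefZ fps_coefzM.
Qed.

Lemma fps_coefX_lt f i n : f`[0] = 0 -> (n < i)%N -> (f ^+ i)`[n] = 0.
Proof.
move=> f0; elim: i n => [//|i IHi] n lt.
rewrite exprS fps_coefM big_ord_recl /= f0 mul0r add0r big1 // => j _.
by rewrite IHi ?mulr0 // /bump /=; have := ltn_ord j; lia.
Qed.

(* The inverse of [1 - h] is the geometric series in [h], which is a finite sum
   in each degree. *)
Lemma unitary_unit f : unitary f -> f \is a GRing.unit.
Proof.
move=> f1; pose h := 1 - f; have fE : f = 1 - h by rewrite /h opprB addrCA subrr addr0.
have h0 : h`[0] = 0 by rewrite fps_coefD fps_coefN f1 fps_coef1 subrr.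
have sumE n m : (\sum_(i < n) h ^+ i)`[m] = \sum_(i < n) (h ^+ i)`[m].
  by elim/big_rec2: _ => // i x y _ <-.
have stable n m : (m <= n)%N ->
    (\sum_(i < n.+1) h ^+ i)`[m] = (\sum_(i < m.+1) h ^+ i)`[m].
  move=> le; rewrite !sumE [RHS](big_ord_widen n.+1 (fun i => (h ^+ i)`[m])) //.
  rewrite [RHS]big_mkcond; apply: eq_bigr => i _.
  by case: ltnP => // lt; exact: fps_coefX_lt.
apply/unitrPr; exists (Fps (fun m => (\sum_(i < m.+1) h ^+ i)`[m])).
apply/fpsP => n; rewrite mulrC fps_coefM fps_coef1.
transitivity (((\sum_(i < n.+1) h ^+ i) * f)`[n]).
  rewrite fps_coefM; apply: eq_bigr => m _; congr (_ * _).
  by rewrite [LHS]/= stable // -ltnS.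
have -> : (\sum_(i < n.+1) h ^+ i) * f = 1 - h ^+ n.+1.
  by rewrite -opprB subrX1 -mulNr opprB -fE mulrC.
by rewrite fps_coefD fps_coefN fps_coef1 fps_coefX_lt // subr0.
Qed.

Lemma unitary_div f g : unitary f -> unitary g -> unitary (f / g).
Proof.
move=> f1 g1; have := divrK (unitary_unit g1) f.
by move=> /(congr1 (fun h => h`[0])); rewrite fps_coef0M g1 mulr1 f1.
Qed.

End PowerSeries.

(** * Schur determinants as linear systems for polynomial multiples of a series *)

Section Hankel.

(* [hankel s k i] is the matrix of S_(k+1+i, (k+1)^(k-1)).  The coefficient
   indices are written so that [k <= m] implies [m.+1 - k + j] is the degree
   paired with [k.-1 - j] in the convolution of [s] with a polynomial of
   degree less than [k], at degree [m]. *)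
Definition hankel_row (k i r : nat) : nat :=
  if r == 0 then (k + k + i)%N else (k + k - r)%N.

Definition hankel (R : comNzRingType) (s : {fps R}) (k i : nat) : 'M[R]_k :=
  \matrix_(r < k, j < k) s`[(hankel_row k i r).+1 - k + j].

Section Ring.
Variable R : comNzRingType.
Implicit Types (s p : {fps R}).

Lemma schur_det s la k : size la = k ->
  schur s la =
  \det (\matrix_(i < k, j < k) complete s (la`_i + j%:Z - i%:Z)).
Proof. by move=> <-. Qed.

Lemma complete_nat s (m : int) (n : nat) : m = n%:Z -> complete s m = s`[n].
Proof. by move=> ->. Qed.

(** All indices in this determinant are positive, so the zero values of [complete] never occur. *)
Lemma schur_hankel s k i :
  schur s ((k.+2 + i)%N%:Z :: nseq k k.+2%:Z) = \det (hankel s k.+1 i).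
Proof.
rewrite (@schur_det _ _ k.+1) /= ?size_nseq //; congr (\det _).
apply/matrixP => r j; rewrite !mxE /hankel_row.
case: r => -[|r] ltr /=; first by congr (s`[_]); lia.
rewrite nth_nseq; have -> : (r < k)%N by lia.
by apply: complete_nat; lia.
Qed.

Lemma schur_rect_hankel s k : (1 <= k)%N ->
  schur s (nseq k k.+1%:Z) = \det (hankel s k 0).
Proof. by case: k => [//|k] _; rewrite -schur_hankel addn0. Qed.

(** The convolution is cut to its first [k] terms and reversed, so that the index of [s] increases
    with the column, as in a Schur determinant. *)
Lemma fps_coefM_poly p s k m :
  (forall n, (k <= n)%N -> p`[n] = 0) -> (k <= m.+1)%N ->
  (p * s)`[m] = \sum_(j < k) s`[m.+1 - k + j] * p`[k.-1 - j].
Proof.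
move=> pk le; rewrite fps_coefM.
rewrite (bigID (fun i : 'I__ => (i < k)%N)) /= [X in _ + X]big1 => [|i]; last first.
  by rewrite -leqNgt => /pk ->; rewrite mul0r.
rewrite addr0 -(big_ord_widen _ (fun i => p`[i] * s`[m - i])) //.
rewrite (reindex_inj rev_ord_inj) /=; apply: eq_bigr => j _.
by rewrite mulrC; congr (s`[_] * p`[_]); have := ltn_ord j; lia.
Qed.

(** Row 0 reads degree 2k+i of the product, and rows 1, ..., k-1 read degrees 2k-1 down to k+1. *)
Lemma hankel_mul p s k i :
  (forall n, (k <= n)%N -> p`[n] = 0) ->
  hankel s k i *m (\col_j p`[k.-1 - j]) =
  \col_(r < k) (p * s)`[hankel_row k i r].
Proof.
move=> pk; apply/colP => r; rewrite !mxE (fps_coefM_poly s pk); last first.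
  by rewrite /hankel_row; have := ltn_ord r; case: ifP; lia.
by apply: eq_bigr => j _; rewrite !mxE.
Qed.

(** The parameter [i] enters row 0 only, which these minors delete. *)
Lemma hankel_cofactor s k i (j : 'I_k.+1) :
  cofactor (hankel s k.+1 i) 0 j = cofactor (hankel s k.+1 0) 0 j.
Proof.
by congr (_ * \det _); apply/matrixP => r l; rewrite !mxE.
Qed.

(* Cramer's rule: the cofactors along the first row do not depend on [i]. *)
Lemma det_hankel p s k i :
  (forall n, (k.+1 <= n)%N -> p`[n] = 0) ->
  (p * s)`[k.+1 + k.+1] = 1 ->
  (forall n, (k.+1 < n < k.+1 + k.+1)%N -> (p * s)`[n] = 0) ->
  \det (hankel s k.+1 i) =
  \det (hankel s k.+1 0) * (p * s)`[k.+1 + k.+1 + i].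
Proof.
move=> pk top low; pose c := \col_(j < k.+1) p`[k - j].
have Hc : hankel s k.+1 0 *m c = delta_mx 0 0.
  rewrite (hankel_mul s 0 pk); apply/colP => r; rewrite !mxE /hankel_row.
  case: eqVneq => [r0|r0].
    by rewrite addn0 top (_ : (r == 0) = true) //; apply/eqP/val_inj.
  rewrite low; last by have := ltn_ord r; lia.
  by rewrite -val_eqE /= (negPf r0).
(* Multiplying the system by the adjugate avoids any division. *)
have cE j : \det (hankel s k.+1 0) * c j 0 = cofactor (hankel s k.+1 0) 0 j.
  have := congr1 (mulmx (\adj (hankel s k.+1 0))) Hc.
  rewrite mulmxA mul_adj_mx mul_scalar_mx -colE.
  by move=> /colP/(_ j); rewrite [in X in _ = X]mxE [X in _ = X]mxE mxE.
rewrite (expand_det_row _ 0) (fps_coefM_poly s pk) ?mulr_sumr; last by lia.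
apply: eq_bigr => j _; rewrite hankel_cofactor -cE !mxE /hankel_row /=.
by rewrite mulrCA.
Qed.

End Ring.

Lemma map_hankel (R S : comNzRingType) (phi : {rmorphism R -> S}) (s : {fps R})
    k i : phi (\det (hankel s k i)) = \det (hankel (map_fps phi s) k i).
Proof.
by rewrite -det_map_mx; congr (\det _); apply/matrixP => r j; rewrite !mxE.
Qed.

(** * Nonvanishing of the determinants through kernels *)

Section Kernel.
Variables (F : fieldType) (s : {fps F}) (k : nat).

Lemma hankel_kernel p :
  \det (hankel s k 0) != 0 ->
  (forall n, (k <= n)%N -> p`[n] = 0) ->
  (forall n, (k < n <= k + k)%N -> (p * s)`[n] = 0) ->
  p = 0.
Proof.
move=> D0 pk zero; have H0 : hankel s k 0 *m (\col_j p`[k.-1 - j]) = 0.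
  rewrite (hankel_mul s 0 pk); apply/colP => r; rewrite !mxE.
  by apply: zero; rewrite /hankel_row; have := ltn_ord r; case: ifP; lia.
have /(congr1 (mulmx (invmx (hankel s k 0)))) := H0.
rewrite mulKmx ?unitmxE ?unitfE // mulmx0 => c0.
apply/fpsP => n; rewrite fps_coef0; case: (leqP k n) => [/pk //|lt].
have lt' : (k.-1 - n < k)%N by lia.
move/colP/(_ (Ordinal lt')): c0; rewrite !mxE /= => <-.
by congr p`[_]; lia.
Qed.

Lemma hankel_neq0 :
  (forall p : {fps F}, (forall n, (k <= n)%N -> p`[n] = 0) ->
    (forall n, (k < n <= k + k)%N -> (p * s)`[n] = 0) -> p = 0) ->
  \det (hankel s k 0) != 0.
Proof.
(* [det0P] yields a left kernel vector, hence the transposition. *)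
move=> inj; rewrite -det_tr; apply/negP => /det0P[v v0 vH].
(* Column [j] is paired with the coefficient of degree k-1-j, so the kernel vector is read
   backwards. *)
pose p : {fps F} := Fps (fun n =>
  if insub n is Some j then v 0 (rev_ord (j : 'I_k)) else 0).
have pk n : (k <= n)%N -> p`[n] = 0 by move=> le; rewrite /= insubN // -leqNgt.
have vE : v^T = \col_j p`[k.-1 - j].
  apply/colP => j; rewrite !mxE /=; have ltj := ltn_ord j.
  rewrite insubT => [|lt]; first by lia.
  by congr (v _ _); apply/val_inj => /=; lia.
case/eqP: v0; apply/trmx_inj; rewrite trmx0 vE.
suff -> : p = 0 by apply/colP => j; rewrite !mxE.
apply: inj => // n nk.
have := congr1 trmx vH; rewrite trmx_mul trmxK trmx0 vE (hankel_mul s 0 pk).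
(* This is the row that reads degree [n]. *)
have lt : ((if n == (k + k)%N then 0 else (k + k - n)%N) < k)%N by case: ifP; lia.
move/colP/(_ (Ordinal lt)); rewrite !mxE => <-.
suff -> : hankel_row k 0 (if n == (k + k)%N then 0 else (k + k - n)%N) = n by [].
by rewrite /hankel_row; case: ifP; case: ifP; lia.
Qed.

(* [t] is a polynomial of degree exactly [k], so [t * q] having degree less than
   [k] is a linear recurrence for [q] which can be run backwards. *)
Lemma backward_recurrence (t q : {fps F}) :
  t`[k] != 0 -> (forall n, (k < n)%N -> t`[n] = 0) ->
  (forall n, (k <= n)%N -> (t * q)`[n] = 0) ->
  (forall n, (k < n <= k + k)%N -> q`[n] = 0) ->
  forall n, (n <= k + k)%N -> q`[n] = 0.
Proof.
move=> tk tgt rec zero.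
have back n : (forall m, (n < m <= n + k)%N -> q`[m] = 0) -> q`[n] = 0.
  move=> qn; have := rec (n + k)%N (leq_addl _ _).
  have ltk : (k < (n + k).+1)%N by lia.
  (* The term of index [k] isolates [q] at [n]; the later ones vanish with [t], the earlier ones by
     [qn]. *)
  rewrite fps_coefM (bigD1 (Ordinal ltk)) //= addnK big1 => [|i].
    by rewrite addr0 => /eqP; rewrite mulf_eq0 (negPf tk) => /eqP.
  rewrite -val_eqE /= => ik; case: (ltnP k i) => [/tgt ->|le].
    by rewrite mul0r.
  by rewrite qn ?mulr0 //; lia.
suff down m : forall n, (k.+1 <= n + m)%N -> (n <= k + k)%N -> q`[n] = 0.
  by move=> n; apply: (down k.+1); lia.
elim: m => [|m IHm] n nm nk; first by apply: zero; lia.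
case: (leqP k.+1 (n + m)) => lt; first exact: IHm.
by apply: back => j lej; apply: IHm; lia.
Qed.

(** The recurrence is [t * (p * s) = p], with [p] of degree less than [k]; once [p * s] vanishes in
    low degrees, the same identity gives [p = 0]. *)
Lemma hankel_inv_neq0 (t : {fps F}) :
  t * s = 1 -> t`[k] != 0 -> (forall n, (k < n)%N -> t`[n] = 0) ->
  \det (hankel s k 0) != 0.
Proof.
move=> ts tk tgt; apply: hankel_neq0 => p pk zero.
have pE : t * (p * s) = p by rewrite mulrCA ts mulr1.
have rec n : (k <= n)%N -> (t * (p * s))`[n] = 0 by rewrite pE; exact: pk.
have ps0 := backward_recurrence tk tgt rec zero.
apply/fpsP => n; rewrite fps_coef0; case: (leqP k n) => [/pk //|lt].
rewrite -pE fps_coefM big1 // => i _.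
by rewrite ps0 ?mulr0 //; have := ltn_ord i; lia.
Qed.

End Kernel.
End Hankel.

(** * Euclidean division of a unitary series by 1 *)

Section Division.
Variables (F : fieldType) (s : {fps F}).
Implicit Types f g h p u : {fps F}.

(* Up to polynomials of degree at most [k.+1] and [k], the series
   [z^(2k) f_(k-1)] and [z^(2k) f_k] are multiples of [s] by polynomials [u] and
   [p] of degree at most [k] and less than [k]. *)
Definition pade_pair k g f := exists u p,
  [/\ u`[0] != p`[0],
      forall n, (k < n)%N -> u`[n] = 0,
      forall n, (k <= n)%N -> p`[n] = 0,
      forall n, (k.+1 < n)%N -> ('z ^+ (k + k) * g)`[n] = (u * s)`[n] &
      forall n, (k < n)%N -> ('z ^+ (k + k) * f)`[n] = (p * s)`[n]].

Lemma pade_pair0 : pade_pair 0 s 1.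
Proof.
exists 1, 0; split=> [||//||].
- exact: oner_neq0.
- by move=> [].
- by move=> n _; rewrite expr0.
- by move=> [//|n] _; rewrite expr0 mul1r mul0r fps_coef1.
Qed.

(** The factor 1+az brings in degree n-1, so agreement for [f] above degree [k] serves above degree
    [k.+1]. *)
Lemma pade_combine k g f u p a n :
  (forall n, (k.+1 < n)%N -> ('z ^+ (k + k) * g)`[n] = (u * s)`[n]) ->
  (forall n, (k < n)%N -> ('z ^+ (k + k) * f)`[n] = (p * s)`[n]) ->
  (k.+1 < n)%N ->
  ('z ^+ (k + k) * (g - (1 + a *: 'z) * f))`[n] =
  ((u - (1 + a *: 'z) * p) * s)`[n].
Proof.
move=> us ps ltn; rewrite mulrBr mulrBl mulrCA -(mulrA _ p).
rewrite !(fps_coefD, fps_coefN, fps_coef_affM) us // ps 1?ltnW //.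
by case: n ltn => [//|n] ltn; rewrite ps.
Qed.

Lemma pade_degree k u p a n :
  (forall n, (k < n)%N -> u`[n] = 0) -> (forall n, (k <= n)%N -> p`[n] = 0) ->
  (k < n)%N -> (u - (1 + a *: 'z) * p)`[n] = 0.
Proof.
case: n => [//|n] uk pk ltn; rewrite fps_coefD fps_coefN fps_coef_affM uk //.
by rewrite (pk n) // pk 1?ltnW // mulr0 addr0 subr0.
Qed.

Lemma pade_pair_step k g f h a b : b != 0 ->
  g = (1 + a *: 'z) * f + b *: ('z ^+ 2 * h) ->
  pade_pair k g f -> pade_pair k.+1 f h.
Proof.
move=> b0 gE [u [p [u0 uk pk us ps]]].
have hE : 'z ^+ (k.+1 + k.+1) * h =
    b^-1 *: ('z ^+ (k + k) * (g - (1 + a *: 'z) * f)).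
  rewrite gE [X in X - _]addrC addrK.
  by rewrite fps_scaleAr scalerA mulVf // scale1r mulrA -exprD addn2 addSn addnS.
(* The exponent 2k grows by 2: for [f] the extra square of z multiplies [p], while for [h] it
   cancels the one in the division. *)
exists ('z ^+ 2 * p), (b^-1 *: (u - (1 + a *: 'z) * p)); split.
(* The new constant coefficients are 0 and a nonzero multiple of the difference of the old ones. *)
- rewrite fps_coefZ fps_coefD fps_coefN fps_coef_affM mulr0 addr0 fps_coefXzM.
  by rewrite eq_sym mulf_eq0 invr_eq0 (negPf b0) subr_eq0.
- move=> n ltn; rewrite fps_coefXzM; case: ifP => // _; apply: pk; lia.
- by move=> n ltn; rewrite fps_coefZ (pade_degree _ uk pk) ?mulr0.
- move=> n ltn; rewrite addSn addnS -[(k + k).+2]add2n exprD -!(mulrA ('z ^+ 2)).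
  by rewrite !(fps_coefXzM _ 2); case: ifP => // _; apply: ps; lia.
move=> n ltn; rewrite hE fps_scaleAl !fps_coefZ; congr (_ * _).
exact: pade_combine.
Qed.

(** As [f] is unitary, its shift by 2k has coefficient 1 in degree 2k and 0 below, which are the
    conditions of [det_hankel] on [p * s]. *)
Lemma pade_pair_eq k g f : unitary f -> (1 <= k)%N ->
  \det (hankel s k 0) != 0 -> pade_pair k g f ->
  f = (schur s (nseq k k.+1%:Z))^-1 *:
      Fps (fun i => schur s ((k.+1 + i)%N%:Z :: nseq k.-1 k.+1%:Z)).
Proof.
move=> f1 k1 D0 [_ [p [_ _ pk _ ps]]]; apply/fpsP => i.
rewrite fps_coefZ schur_rect_hankel //.
case: k k1 D0 pk ps => [//|k] _ D0 pk ps /=.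
have fE m : f`[m] = (p * s)`[k.+1 + k.+1 + m].
  by rewrite -ps ?fps_coefXzDM //; lia.
rewrite schur_hankel (det_hankel i pk) ?mulKf ?fE //.
  by rewrite -[X in _`[X]]addn0 -fE.
move=> n /andP[lo hi]; rewrite -ps // fps_coefXzM hi //.
Qed.

(** The scalar alpha is forced by cancellation in degree 1, and beta is then the coefficient of [e]
    in degree 2. *)
Definition next_remainder g f : {fps F} :=
  let e := g - (1 + (g`[1] - f`[1]) *: 'z) * f in
  Fps (fun n => (e`[2])^-1 * e`[n.+2]).

(* A vanishing [beta] would produce a kernel vector of the next Hankel
   matrix. *)
Lemma next_remainderP k g f : unitary g -> unitary f ->
  \det (hankel s k.+1 0) != 0 -> pade_pair k g f ->
  unitary (next_remainder g f) /\
  exists a b, b != 0 /\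
    g = (1 + a *: 'z) * f + b *: ('z ^+ 2 * next_remainder g f).
Proof.
rewrite /unitary => g1 f1 D0 [u [p [u0 uk pk us ps]]].
set a := g`[1] - f`[1]; pose e := g - (1 + a *: 'z) * f.
have e0 : e`[0] = 0.
  by rewrite fps_coefD fps_coefN fps_coef_affM g1 f1 mulr0 addr0 subrr.
have e1 : e`[1] = 0.
  by rewrite fps_coefD fps_coefN fps_coef_affM f1 mulr1 /a (addrC f`[1]) subrK subrr.
have b0 : e`[2] != 0.
  (* Otherwise [e] starts in degree 3 at least, so [r * s] vanishes in degrees k+2, ..., 2k+2; then
     [r = 0], against [u0]. *)
  apply/eqP => e2; pose r := u - (1 + a *: 'z) * p.
  have r0 : r = 0.
    apply: (hankel_kernel D0) => n; first exact: pade_degree.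
    move=> /andP[lo hi].
    rewrite -(pade_combine a us ps) // fps_coefXzM; case: ifP => // _.
    have : (n - (k + k) <= 2)%N by lia.
    by case: (n - (k + k))%N => [|[|[|]]].
  have /eqP : r`[0] = 0 by rewrite r0.
  rewrite fps_coefD fps_coefN fps_coef_affM mulr0 addr0 subr_eq0.
  by rewrite (negPf u0).
split; first by rewrite /= mulVf.
exists a, e`[2]; split=> //; apply/eqP; rewrite addrC -subr_eq; apply/eqP.
apply/fpsP => -[|[|n]]; rewrite fps_coefZ fps_coefXzM /= ?mulr0 //.
by rewrite subn2 /= mulVKf.
Qed.

Section Remainders.
Hypothesis s1 : unitary s.
Hypothesis D0 : forall k, (1 <= k)%N -> \det (hankel s k 0) != 0.

Lemma successive_remainders_pade (f : nat -> {fps F}) : successive_remainders s 1 f ->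
  forall k, pade_pair k (if k is j.+1 then f j else s) (f k).
Proof.
move=> [f0 fS]; elim=> [|k IHk]; first by rewrite f0; exact: pade_pair0.
have [_ [a [b [b0 E]]]] := fS k; exact: pade_pair_step b0 E IHk.
Qed.

Lemma successive_remainders_schur (f : nat -> {fps F}) : successive_remainders s 1 f ->
  forall k, (1 <= k)%N ->
  f k = (schur s (nseq k k.+1%:Z))^-1 *:
      Fps (fun i => schur s ((k.+1 + i)%N%:Z :: nseq k.-1 k.+1%:Z)).
Proof.
move=> fP k k1; apply: pade_pair_eq (D0 k1) (successive_remainders_pade fP k) => //.
by case: fP => _ fS; case: k k1 => // k _; case: (fS k).
Qed.

Lemma successive_remainders_exist : exists f : nat -> {fps F}, successive_remainders s 1 f.
Proof.
(* The state holds two consecutive terms, starting from the dividend and the divisor. *)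
pose w k := iter k (fun gf => (gf.2, next_remainder gf.1 gf.2)) (s, 1).
have inv k : [/\ unitary (w k).1, unitary (w k).2 & pade_pair k (w k).1 (w k).2].
  elim: k => [|k [g1 f1 gf]]; first by split=> //; exact: pade_pair0.
  have [//|//||//|h1 [a [b [b0 E]]]] := @next_remainderP k (w k).1 (w k).2.
    exact: D0.
  by split=> //; exact: pade_pair_step b0 E gf.
exists (fun k => (w k).2); split=> // k.
have [g1 f1 gf] := inv k.
have [//|//||//|h1 h] := @next_remainderP k (w k).1 (w k).2; first exact: D0.
by split=> //; case: k {g1 f1 gf h1} h.
Qed.

End Remainders.

(** The division relation is linear in the series, with the same scalars after multiplication by a
    unit; a unitary [f0] also preserves unitarity. *)
Lemma successive_remainders_div fm1 f0 (f : nat -> {fps F}) : unitary f0 ->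
  successive_remainders fm1 f0 f <->
  successive_remainders (fm1 / f0) 1 (fun k => f k / f0).
Proof.
move=> u0; have U := unitary_unit u0.
split=> -[f0E fS].
  split=> [|k]; first by rewrite f0E divrr.
  have [f1 [a [b [b0 E]]]] := fS k; split; first exact: unitary_div.
  exists a, b; split=> //.
  transitivity ((if k is j.+1 then f j else fm1) / f0); first by case: (k).
  by rewrite E mulrDl fps_scaleAl !mulrA.
have fE k : f k = f k / f0 * f0 by rewrite divrK.
split=> [|k]; first by rewrite fE f0E mul1r.
have [f1 [a [b [b0 E]]]] := fS k; split.
  by rewrite fE /unitary fps_coef0M f1 u0 mulr1.
exists a, b; split=> //.
transitivity ((if k is j.+1 then f j / f0 else fm1 / f0) * f0).
  by case: (k) => [|j]; rewrite divrK.
by rewrite E mulrDl fps_scaleAl -!mulrA mulVr // !mulr1.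
Qed.

End Division.

(** * Evaluation of polynomials with all letters equal to 1 *)

Section Specialization.
Variable L : choiceType.

Definition monom_to_one (m : {cmonom L}) : rat := 1.

Lemma monom_to_one_mmorphism : mmorphism monom_to_one.
Proof. by split=> [m1 m2|//]; rewrite /monom_to_one mulr1. Qed.

HB.instance Definition _ := isMultiplicative.Build {cmonom L} rat
  monom_to_one monom_to_one_mmorphism.

Definition letters_to_one : polyring L -> rat :=
  mmap (intr : int -> rat) monom_to_one.

HB.instance Definition _ := GRing.RMorphism.on letters_to_one.

Lemma letters_to_one_letter a : letters_to_one (letter a) = 1.
Proof. by rewrite /letters_to_one /letter mmapU mul1r. Qed.

End Specialization.

(** * Specialization of the generic determinants *)

Section Evaluation.
Variables A B : choiceType.

(** In this encoding, setting the letters outside [FG] to 0 is evaluation at [FG]. *)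
Definition eval_sub (FG : subalphabets A B) (x : complete_ring A B) :
  polyring (A + B)%type := complete_val x FG.

Lemma eval_sub_is_zmod_morphism FG : zmod_morphism (eval_sub FG).
Proof. by move=> x y. Qed.

Lemma eval_sub_is_monoid_morphism FG : monoid_morphism (eval_sub FG).
Proof. by []. Qed.

HB.instance Definition _ FG := GRing.isZmodMorphism.Build _ _
  (eval_sub FG) (eval_sub_is_zmod_morphism FG).
HB.instance Definition _ FG := GRing.isMonoidMorphism.Build _ _
  (eval_sub FG) (eval_sub_is_monoid_morphism FG).

(** Evaluation is defined on [complete_ring] but not on its fractions, so the series are needed
    before passing to the field. *)
Definition seriesA : {fps complete_ring A B} :=
  Fps (fun i => CompleteRing (@completeA_generated A B i)).
Definition seriesB : {fps complete_ring A B} :=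
  Fps (fun i => CompleteRing (@completeB_generated A B i)).

Lemma eval_seriesA FG : map_fps (eval_sub FG) seriesA = sigma_fin inl FG.1.
Proof. exact/fpsP. Qed.

Lemma eval_seriesB FG : map_fps (eval_sub FG) seriesB = sigma_fin inr FG.2.
Proof. exact/fpsP. Qed.

Lemma seriesA_unitary : unitary seriesA.
Proof. by apply/val_inj/funext => FG; exact: sigma_fin0. Qed.

Lemma seriesB_unitary : unitary seriesB.
Proof. by apply/val_inj/funext => FG; exact: sigma_fin0. Qed.

Lemma sigmaAE : sigmaA A B = map_fps (@tofrac _) seriesA.
Proof. by []. Qed.

Lemma sigmaBE : sigmaB A B = map_fps (@tofrac _) seriesB.
Proof. by []. Qed.

Lemma map_unitary (R S : comNzRingType) (phi : {rmorphism R -> S}) f :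
  unitary f -> unitary (map_fps phi f).
Proof. by rewrite /unitary /= => ->; rewrite rmorph1. Qed.

Lemma sigmaA_unitary : unitary (sigmaA A B).
Proof. by rewrite sigmaAE; exact/map_unitary/seriesA_unitary. Qed.

Lemma sigmaB_unitary : unitary (sigmaB A B).
Proof. by rewrite sigmaBE; exact/map_unitary/seriesB_unitary. Qed.

(** Shows that the k-th power of 1-z can serve as [t] in [hankel_inv_neq0]. *)
Lemma exp_one_sub_z (R : comNzRingType) k :
  ((1 - 'z : {fps R}) ^+ k)`[k] = (-1) ^+ k /\
  forall n, (k < n)%N -> ((1 - 'z : {fps R}) ^+ k)`[n] = 0.
Proof.
elim: k => [|k [IH1 IH2]]; first by split=> // -[].
have E n : ((1 - 'z : {fps R}) ^+ k.+1)`[n.+1] =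
    ((1 - 'z) ^+ k)`[n.+1] - ((1 - 'z) ^+ k)`[n].
  by rewrite exprS mulrBl mul1r fps_coefD fps_coefN fps_coefzM.
split=> [|[//|n] ltn]; first by rewrite E IH2 // IH1 sub0r exprS mulN1r.
by rewrite E !IH2 ?subr0 // ltnW.
Qed.

Lemma sigma_fin_to_one (T : choiceType) (inj : T -> (A + B)%type) (F : {fset T}) :
  (1 - 'z) ^+ #|` F| * map_fps (@letters_to_one _) (sigma_fin inj F) = 1.
Proof.
rewrite rmorph_prod /=.
have E a : map_fps (@letters_to_one _) (1 - letter (inj a) *: 'z)^-1 = (1 - 'z)^-1.
  rewrite -[LHS]/(map_fps _ _) map_geometricV /=.
  by rewrite letters_to_one_letter scale1r.
under eq_bigr => a _ do rewrite E.
rewrite big_const_seq count_predT iter_mulr_1.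
rewrite exprVn divrr // unitrX //.
by have := geometric_unit (1 : rat); rewrite scale1r.
Qed.

Lemma infinite_fset_card (T : choiceType) k : infinite_set [set: T] ->
  exists F : {fset T}, #|` F| = k.
Proof.
move=> /(@infinite_set_fset _ _ k)[F _ leF].
exists [fset x in take k F]%fset.
rewrite card_fseq undup_id ?take_uniq ?fset_uniq // size_take.
by case: ltngtP leF.
Qed.

Lemma hankel_frac_neq0 (s : {fps complete_ring A B}) :
  infinite_set [set: A] ->
  (forall F, map_fps (eval_sub (F, fset0)) s = sigma_fin inl F) ->
  forall k, \det (hankel (map_fps (@tofrac _) s) k 0) != 0.
Proof.
move=> infA sE k; rewrite -map_hankel tofrac_eq0.
(* The number of letters must equal the size of the matrix, which is the order of the recurrence. *)
have [F cF] := infinite_fset_card k infA.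
(* A ring morphism sends 0 to 0, so nonvanishing may be tested on the image. *)
suff : letters_to_one (eval_sub (F, fset0) (\det (hankel s k 0))) != 0.
  by apply: contra => /eqP ->; rewrite !rmorph0.
rewrite !map_hankel sE; have [tk tgt] := exp_one_sub_z rat k.
apply: (hankel_inv_neq0 (t := (1 - 'z) ^+ k)) => //.
  by rewrite -cF sigma_fin_to_one.
by rewrite tk signr_eq0.
Qed.

Lemma hankel_sigmaA_neq0 k : infinite_set [set: A] ->
  \det (hankel (sigmaA A B) k 0) != 0.
Proof.
by move=> infA; rewrite sigmaAE; apply: hankel_frac_neq0 => // F; exact: eval_seriesA.
Qed.

(* Emptying the second alphabet specializes A - B to A. *)
Lemma hankel_sigmaAB_neq0 k : infinite_set [set: A] ->
  \det (hankel (sigmaA A B / sigmaB A B) k 0) != 0.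
Proof.
move=> infA; have U := unitary_unit seriesB_unitary.
have -> : sigmaA A B / sigmaB A B = map_fps (@tofrac _) (seriesA / seriesB).
  by rewrite rmorphM rmorphV.
apply: hankel_frac_neq0 => // F.
rewrite rmorphM rmorphV //.
rewrite [X in X / _]eval_seriesA [X in _ / X]eval_seriesB.
by rewrite [sigma_fin inr _]big_seq_fset0 invr1 mulr1.
Qed.

End Evaluation.

Theorem mainTheorem1 (A B : choiceType)
    (infA : infinite_set [set: A]) (infB : infinite_set [set: B]) :
  ((exists f : nat -> {fps (complete_field A B)},
      successive_remainders (sigmaA A B) 1 f) /\
   (forall f : nat -> {fps (complete_field A B)},
      successive_remainders (sigmaA A B) 1 f ->
      forall k : nat, (1 <= k)%N ->
        f k = (schur (sigmaA A B) (nseq k k.+1%:Z))^-1 *: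
          Fps (fun i : nat =>
            schur (sigmaA A B) ((k.+1 + i)%N%:Z :: nseq k.-1 k.+1%:Z)))) /\
  ((exists f : nat -> {fps (complete_field A B)},
      successive_remainders (sigmaA A B) (sigmaB A B) f) /\
   (forall f : nat -> {fps (complete_field A B)},
      successive_remainders (sigmaA A B) (sigmaB A B) f ->
      forall k : nat, (1 <= k)%N ->
        f k = (schur (sigmaA A B / sigmaB A B) (nseq k k.+1%:Z))^-1 *:
          (sigmaB A B *
           Fps (fun i : nat =>
             schur (sigmaA A B / sigmaB A B)
               ((k.+1 + i)%N%:Z :: nseq k.-1 k.+1%:Z))))).
Proof.
have uA := sigmaA_unitary A B; have uB := sigmaB_unitary A B.
have DA k (_ : (1 <= k)%N) := hankel_sigmaA_neq0 B k infA.
have DAB k (_ : (1 <= k)%N) := hankel_sigmaAB_neq0 B k infA.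
have uAB := unitary_div uA uB; have UB := unitary_unit uB.
split; split.
- exact: successive_remainders_exist.
- by move=> f fP k k1; exact: successive_remainders_schur.
- have [f fP] := successive_remainders_exist uAB DAB.
  (* Remainders for the quotient divided by 1 are rescaled by the divisor. *)
  exists (fun k => f k * sigmaB A B); apply/successive_remainders_div => //.
  by under eq_fun do rewrite mulrK //.
move=> f /(successive_remainders_div _ _ uB) fP k k1.
have := successive_remainders_schur DAB fP k1.
move=> /(congr1 ( *%R^~ (sigmaB A B))); rewrite divrK // => ->.
by rewrite fps_scaleAl [_ * sigmaB A B]mulrC.
Qed.
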